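(* Suppose $q$ is a prime power and $a,b,c,d\in\mathbb{F}_{q^2}$. Write $f(X):=aX^{3q} + bX^{2q+1} + cX^{q+2} + d X^3 \in \mathbb{F}_{q^2}[X]$. Then $f(X)$ permutes $\mathbb{F}_{q^2}$ if and only if (the function induced by) $f(X)$ is $\mathbb{F}_q$-linearly equivalent to one of the following: (1) $X^{q+2}$ (as a map on $\mathbb{F}_{q^2}$), where $q\not\equiv 1\pmod 3$; (2) $(X^3,Y^3)$ (as a map on $\mathbb{F}_q\times\mathbb{F}_q$), where $q\not\equiv 1\pmod 3$; (3) $(X^3-eXY^2,Y^3)$ (as a map on $\mathbb{F}_q\times\mathbb{F}_q$) for some nonsquare $e\in\mathbb{F}_q^*$, where $q\equiv 0\pmod 3$.
   Context: If $U$ and $V$ are $\mathbb{F}_q$-vector spaces, a function $f\colon U\to U$ is $\mathbb{F}_q$-linearly equivalent to a function $g\colon V\to V$ if $f=\rho\circ g\circ\eta^{-1}$ for some $\mathbb{F}_q$-vector space isomorphisms $\rho$ and $\eta$ from $V$ to $U$. Here $\mathbb{F}_{q^2}$ and $\mathbb{F}_q\times\mathbb{F}_q$ are viewed as $\mathbb{F}_q$-vector spaces. *)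

(* Defs.v *)
From HB Require Import structures.
From mathcomp Require Import all_boot all_order all_algebra all_field.
Set Implicit Arguments. Unset Strict Implicit. Unset Printing Implicit Defensive.
Import GRing.Theory.
Local Open Scope ring_scope.

Definition Flinear (F : fieldType) (U V : zmodType)
  (sU : F -> U -> U) (sV : F -> V -> V) (h : U -> V) : Prop :=
  (forall x y, h (x + y) = h x + h y) /\ (forall c x, h (sU c x) = sV c (h x)).

(* f : U -> U is F-linearly equivalent to g : V -> V :
   f = rho \o g \o eta^-1 with rho, eta : V -> U F-linear bijections
   (equivalently f \o eta = rho \o g). *)
Definition lin_equiv (F : fieldType) (U V : zmodType)
  (sU : F -> U -> U) (sV : F -> V -> V) (f : U -> U) (g : V -> V) : Prop :=
  exists rho eta : V -> U,
    [/\ Flinear sV sU rho, bijective rho, Flinear sV sU eta, bijective eta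
      & forall v, f (eta v) = rho (g v)].

(* F_{q^2} viewed as an F_q vector space via the embedding iota *)
Definition scaleL (F L : fieldType) (iota : F -> L) (c : F) (x : L) : L :=
  iota c * x.

Definition scaleP (F : fieldType) (c : F) (v : F * F) : F * F :=
  (c * v.1, c * v.2).

Definition fpoly (L : fieldType) (q : nat) (a b c d : L) : {poly L} :=
  a *: 'X^(3 * q) + b *: 'X^(2 * q + 1) + c *: 'X^(q + 2) + d *: 'X^3.

(* Main.v *)
Require Import Defs.
From HB Require Import structures.
From mathcomp Require Import all_boot all_order all_algebra all_field.
From mathcomp Require Import ring zify.
(** In an F-basis of L the map f becomes a pair of binary cubic forms over F, homogeneous of
    degree 3; if it is bijective then q is not 1 mod 3, so cubing is bijective on F and f permutes
    the projective line.  Moving one rational point and its image to infinity leaves either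
    (X^3, Y^3) or the affine map h(x) = x + (r x + s) / (x^2 - t x + m), whose denominator has
    no root in F.  Since h permutes F, the sums of h^k over F equal those of x^k; for k = 1, 2, 3
    partial fractions over L evaluate them explicitly (in every characteristic, with q = 2 handled
    apart) and leave only two candidates.  One is r = s = 0, where the two forms share the factor
    x^2 - t x y + m y^2, a norm from L: this is X^(q+2).  In the other one, with D = t^2 - 4m,
    r = -2D and s = tD: the pencil spanned by the two forms contains two cubes of linear forms if
    q = 2 mod 3, and one if 3 divides q. *)

Set Implicit Arguments.
Unset Strict Implicit.
Import GRing.Theory.
Local Open Scope ring_scope.

(** * Powers, roots of unity and cubing in a finite field *)

Lemma expf_card_pred (K : finFieldType) (x : K) : x != 0 -> x ^+ #|K|.-1 = 1.
Proof.
move=> x0; apply: (mulfI x0).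
by rewrite mulr1 -exprS (ltn_predK (card_finNzRing_gt1 K)) expf_card.
Qed.

(** A Bezout relation [u * n = v * #|K|.-1 + 1] makes the [u]-th power a left inverse; it forces [u]
    to be nonzero, so 0 is recovered too. *)
Lemma expf_coprime_inj (K : finFieldType) (n : nat) :
  (0 < n)%N -> coprime n #|K|.-1 -> injective (fun x : K => x ^+ n).
Proof.
move=> n0 co x y /=; have [u v e _] := egcdnP #|K|.-1 n0.
have xK (z : K) : (z ^+ n) ^+ u = z.
  have [->|z0] := eqVneq z 0.
    rewrite -exprM expr0n muln_eq0 -!leqn0 leqNgt n0 /=.
    by case: u e => // e; move: e co; rewrite mul0n => e; rewrite /coprime => /eqP c; rewrite c addn1 in e.
  have z1 := expf_card_pred z0.
  by rewrite -exprM mulnC e (eqP co) addn1 exprS mulnC exprM z1 expr1n mulr1.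
by move=> exy; rewrite -(xK x) exy xK.
Qed.

(** [X^k - 1] has at most [k] roots, fewer than there are nonzero elements. *)
Lemma expf_neq1 (K : finFieldType) (k : nat) :
  (0 < k < #|K|.-1)%N -> exists2 z : K, z != 0 & z ^+ k != 1.
Proof.
move=> /andP[k0 kq]; apply/exists_inP; apply: contraLR kq.
rewrite negb_exists -leqNgt => /forallP H.
have sz : size ('X^k - 1%:P : {poly K}) = k.+1 by rewrite size_XnsubC.
rewrite -ltnS -sz -(cardC1 (0 : K)) cardE; apply: max_poly_roots; last exact: enum_uniq.
  by rewrite -size_poly_eq0 sz.
apply/allP => x; rewrite mem_enum inE => x0.
have := H x; rewrite x0 /= negbK => /eqP e.
by rewrite rootE !hornerE e subrr.
Qed.

Lemma exists_cubic_root1 (K : finFieldType) :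
  (#|K| %% 3 = 1)%N -> exists w : K, 1 + w + w ^+ 2 = 0.
Proof.
move=> h; have q1 : (1 < #|K|)%N := card_finNzRing_gt1 K.
(* This power of [z] is a cube root of unity other than 1. *)
have [|z z0 z1] := @expf_neq1 K (#|K|.-1 %/ 3); first by lia.
exists (z ^+ (#|K|.-1 %/ 3)); set w := z ^+ _ in z1 *.
have w3 : w ^+ 3 = 1.
  rewrite -exprM (_ : (_ * 3)%N = #|K|.-1); last by lia.
  exact: expf_card_pred.
apply/eqP; have : (w - 1) * (1 + w + w ^+ 2) == 0 by apply/eqP; ring: w3.
by rewrite mulf_eq0 subr_eq0 (negPf z1).
Qed.

Lemma cube_inj (K : finFieldType) :
  (#|K| %% 3 != 1)%N -> injective (fun x : K => x ^+ 3).
Proof.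
have q1 : (1 < #|K|)%N := card_finNzRing_gt1 K.
by move=> h; apply: expf_coprime_inj; rewrite // prime_coprime //; lia.
Qed.

(** * The [q]-th power map on an extension of [F] *)

Section BaseExtension.
Variables (F : finFieldType) (K : fieldType) (iota : {rmorphism F -> K}).
Local Notation q := #|F|.

Lemma card_pnat_pchar : [pchar K].-nat q.
Proof.
have [p p_pr pF] := finPcharP F.
have -> : q = (p ^ logn p q)%N by exact: (card_pprimeChar pF).
by rewrite pnatX pnatE // (fmorph_pchar iota) pF.
Qed.

Lemma expDq (x y : K) : (x + y) ^+ q = x ^+ q + y ^+ q.
Proof. exact: exprDn_pchar card_pnat_pchar. Qed.

Lemma expNq (x : K) : (- x) ^+ q = - x ^+ q.
Proof. exact: exprNn_pchar card_pnat_pchar. Qed.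

Lemma expBq (x y : K) : (x - y) ^+ q = x ^+ q - y ^+ q.
Proof. by rewrite expDq expNq. Qed.

Lemma iotaq (x : F) : iota x ^+ q = iota x.
Proof. by rewrite -rmorphXn expf_card. Qed.

(** The [q] elements of [F] are roots of [X^q - X]; one more root would exceed its degree. *)
Lemma fixed_in_base (z : K) : z ^+ q = z -> exists x, z = iota x.
Proof.
move=> zq; suff /existsP[x /eqP->] : [exists x, z == iota x] by exists x.
apply: contraT; rewrite negb_exists => /forallP H.
have q1 : (1 < #|F|)%N := card_finNzRing_gt1 F.
have sz : size ('X^q - 'X : {poly K}) = q.+1.
  by rewrite size_polyDl ?size_polyXn // size_polyN size_polyX ltnS.
have : (size (z :: map iota (enum F)) < size ('X^q - 'X : {poly K})%R)%N.
  apply: max_poly_roots; first by rewrite -size_poly_eq0 sz.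
    apply/allP => x; rewrite inE => /orP[/eqP->|/mapP[y _ ->]];
      by rewrite rootE !hornerE ?zq ?iotaq subrr.
  rewrite /= (map_inj_uniq (fmorph_inj iota)) enum_uniq andbT.
  by apply/mapP => -[y _ e]; have := H y; rewrite e eqxx.
by rewrite sz /= size_map -cardE ltnn.
Qed.

(** The [q]-th power fixes the coefficients, so it sends [nu] to a root; it moves [nu], which lies
    outside [F], and the two roots add up to [t]. *)
Lemma conj_quadratic_root (t m : F) (nu : K) :
  (forall x : F, x ^+ 2 - t * x + m != 0) ->
  nu ^+ 2 - iota t * nu + iota m = 0 ->
  nu ^+ q = iota t - nu /\ nu ^+ q != nu.
Proof.
move=> irr e.
have ne : nu ^+ q != nu.
  apply/eqP => /fixed_in_base[x xe]; case/eqP: (irr x).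
  apply: (fmorph_inj iota); by rewrite rmorph0 rmorphD rmorphB rmorphXn rmorphM -xe.
split=> //.
have : (nu ^+ q) ^+ 2 - iota t * nu ^+ q + iota m = 0.
  have := congr1 (fun z => z ^+ q) e.
  rewrite expDq expBq exprAC (exprMn _ (iota t)) !iotaq => ->.
  by rewrite expr0n -leqn0 leqNgt (ltnW (card_finNzRing_gt1 F)).
set mu := nu ^+ q => e'.
have : (mu - nu) * (mu + nu - iota t) = 0.
  by rewrite -(subrr 0) -{1}e' -e; ring.
move/eqP; rewrite mulf_eq0 subr_eq0 (negPf ne) /= => /eqP h.
by rewrite -[RHS]addr0 -h; ring.
Qed.

End BaseExtension.

(** * Power sums over [F] *)

(** Translation by 1 permutes [F], so the sums of [x] and of [x + 1] agree. *)
Lemma sum_card0 (F : finFieldType) (K : fieldType) (iota : {rmorphism F -> K}) :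
  \sum_(x : F) (1 : K) = 0.
Proof.
have : \sum_(x : F) x = \sum_(x : F) (x + 1).
  exact: (reindex_inj (addIr 1)).
rewrite big_split /= -[LHS]addr0 => /addrI e.
by rewrite -(rmorph1 iota) -rmorph_sum -e rmorph0.
Qed.

(** Replacing [x] by [z * x] multiplies the sum by [z ^+ k], and [z] can be chosen with
    [z ^+ k != 1]. *)
Lemma sum_expf (F : finFieldType) k : (k < #|F|.-1)%N -> \sum_(x : F) x ^+ k = 0.
Proof.
move=> kq; case: (posnP k) => [->|k0].
  exact: (@sum_card0 F F idfun).
have [|z z0 zk] := @expf_neq1 F k; first by rewrite k0.
have : \sum_(x : F) x ^+ k = z ^+ k * \sum_(x : F) x ^+ k.
  rewrite {1}(reindex_inj (mulfI z0)) mulr_sumr.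
  by apply: eq_bigr => x _; rewrite exprMn.
move/eqP; rewrite -subr_eq0 -{1}[\sum_x _]mul1r -mulrBl mulf_eq0 subr_eq0 eq_sym.
by rewrite (negPf zk) => /eqP.
Qed.

Lemma sum_expf_card (F : finFieldType) : \sum_(x : F) x ^+ #|F|.-1 = -1.
Proof.
have q1 : (1 < #|F|)%N := card_finNzRing_gt1 F.
have := @sum_card0 F F idfun; rewrite (bigD1 (0 : F)) //= => e.
rewrite (bigD1 (0 : F)) //= expr0n (_ : (#|F|.-1 == 0)%N = false) ?add0r; last by lia.
apply: (addrI 1); rewrite subrr -{}[RHS]e; congr (_ + _); apply: eq_bigr => x x0.
exact: expf_card_pred.
Qed.

Section PowerSums.
Variables (F : finFieldType) (K : fieldType) (iota : {rmorphism F -> K}).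
Local Notation q := #|F|.

Lemma sum_iota_expf k : (k < q.-1)%N -> \sum_(x : F) iota x ^+ k = 0.
Proof.
move=> h; under eq_bigr do rewrite -rmorphXn.
by rewrite -rmorph_sum sum_expf // rmorph0.
Qed.

Lemma sum_shift_expf (mu : K) k : (k < q.-1)%N ->
  \sum_(x : F) (iota x - mu) ^+ k = 0.
Proof.
move=> h; under eq_bigr do rewrite exprBn.
rewrite exchange_big big1 //= => i _.
rewrite sumrMnl -mulr_suml -mulr_sumr.
rewrite sum_iota_expf ?mulr0 ?mul0r ?mul0rn //.
by apply: leq_ltn_trans h; exact: leq_subr.
Qed.

(** Only the top term of the binomial expansion has a nonzero power sum. *)
Lemma sum_shift_expf_card (mu : K) : \sum_(x : F) (iota x - mu) ^+ q.-1 = -1.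
Proof.
have q1 : (1 < #|F|)%N := card_finNzRing_gt1 F.
under eq_bigr do rewrite exprBn.
rewrite exchange_big /= big_ord_recl /= [X in _ + X]big1 => [|i _].
  rewrite addr0; under eq_bigr do rewrite subn0 bin0 expr0 mul1r mulr1 -rmorphXn.
  by rewrite -rmorph_sum sum_expf_card rmorphN1.
rewrite sumrMnl -mulr_suml -mulr_sumr.
by rewrite sum_iota_expf ?mulr0 ?mul0r ?mul0rn // ltn_subrL /= -ltnS (ltn_predK q1).
Qed.

(* With y = x - mu one has y ^ q = y - W, so that y^-1 = (1 - y ^ (q - 1)) / W is a polynomial
   in x. *)
Lemma sum_inv_shift (mu : K) : mu ^+ q != mu ->
  let W := mu ^+ q - mu in
  [/\ \sum_(x : F) (iota x - mu)^-1 = W^-1,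
      \sum_(x : F) (iota x - mu)^-1 ^+ 2 = W^-1 ^+ 2 &
      (2 < q)%N -> \sum_(x : F) (iota x - mu)^-1 ^+ 3 = W^-1 ^+ 3].
Proof.
move=> ne W; have W0 : W != 0 by rewrite subr_eq0.
have q1 : (1 < #|F|)%N := card_finNzRing_gt1 F.
have y0 (x : F) : iota x - mu != 0.
  by apply: contraNneq ne => /eqP; rewrite subr_eq0 => /eqP <-; rewrite iotaq.
have inv_y (x : F) : (iota x - mu)^-1 = W^-1 * (1 - (iota x - mu) ^+ q.-1).
  apply: (mulfI (y0 x)); rewrite divff // mulrCA mulrBr mulr1 -exprS prednK ?(ltnW q1) //.
  rewrite expBq // iotaq; apply: (mulfI W0); rewrite mulVKf // /W; ring.
(* With y = x - mu, the formula for y^-1 gives y^-(j+1) = (y^-j - y^(q-1-j)) / W. The sum of the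
   last power vanishes unless j = 0. The cubes need j = 2, hence q > 2. *)
have step j : (j < q)%N -> \sum_(x : F) (iota x - mu)^-1 ^+ j.+1 =
    W^-1 * (\sum_(x : F) (iota x - mu)^-1 ^+ j - \sum_(x : F) (iota x - mu) ^+ (q.-1 - j)).
  move=> jq; rewrite -sumrB mulr_sumr; apply: eq_bigr => x _.
  rewrite exprS {1}inv_y -mulrA; congr (_ * _); rewrite mulrBl mul1r; congr (_ - _).
  rewrite -{1}(subnK (_ : j <= q.-1)%N) ?exprD -?mulrA -?exprMn ?divff ?expr1n ?mulr1 //.
  by lia.
have S1 : \sum_(x : F) (iota x - mu)^-1 = W^-1.
  have := step 0%N (ltnW q1); rewrite subn0 sum_shift_expf_card.
  under eq_bigr do rewrite expr1; under [in RHS]eq_bigr do rewrite expr0.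
  by move=> ->; rewrite (sum_card0 iota); ring.
have S2 : \sum_(x : F) (iota x - mu)^-1 ^+ 2 = W^-1 ^+ 2.
  rewrite step // sum_shift_expf; last by lia.
  by under eq_bigr do rewrite expr1; rewrite S1 subr0 expr2.
split=> // q2; rewrite step // sum_shift_expf; last by lia.
by rewrite S2 subr0 -exprS.
Qed.
End PowerSums.

(** * Irreducible quadratics over [F] and partial fractions over [L] *)

(** In a splitting field of the quadratic [p], conjugating a root twice gives it back, so [p] shares
    a root with [X^(q^2) - X] and, being irreducible, divides it. Over [L] this multiple is a
    product of linear factors. *)
Lemma quadratic_root_ext (F L : finFieldType) (iota : {rmorphism F -> L})
    (hL : #|L| = (#|F| ^ 2)%N) (t m : F) :
  (forall x : F, x ^+ 2 - t * x + m != 0) ->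
  exists nu : L, nu ^+ 2 - iota t * nu + iota m = 0.
Proof.
move=> irr; pose p : {poly F} := 'X^2 - t *: 'X + m%:P.
have pE (R : comNzRingType) (phi : {rmorphism F -> R}) z :
    (map_poly phi p).[z] = z ^+ 2 - phi t * z + phi m.
  by rewrite rmorphD rmorphB /= map_polyZ map_polyXn map_polyX map_polyC !hornerE.
have sz : size p = 3.
  rewrite /p -addrA size_polyDl ?size_polyXn // ltnS.
  rewrite (leq_trans (size_polyD _ _)) // geq_max size_polyN.
  by rewrite (leq_trans (size_scale_leq _ _)) ?size_polyX // (leq_trans (size_polyC_leq1 _)).
have p0 : p != 0 by rewrite -size_poly_eq0 sz.
have irrp : irreducible_poly p.
  apply: cubic_irreducible; rewrite ?sz // => x.
  by rewrite rootE !hornerE.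
have dvd : p %| 'X^(#|F| ^ 2) - 'X.
  have [E [[|nu rs] rsE _]] := FinSplittingFieldFor p0.
    by have := eqp_size rsE; rewrite size_map_poly sz big_nil size_poly1.
  have rt : root (map_poly (in_alg E) p) nu.
    by rewrite (eqp_root rsE) root_prod_XsubC mem_head.
  have [|nuq _] := @conj_quadratic_root F E (in_alg E) t m nu irr.
    by rewrite -(pE E (in_alg E) nu); exact/eqP.
  apply: contraT; rewrite -(irreducible_poly_coprime _ irrp).
  rewrite -(coprimep_map (in_alg E)) => /coprimep_root/(_ rt)/eqP[].
  rewrite rmorphB /= map_polyXn map_polyX.  rewrite !hornerE.  rewrite expnS expn1 exprM nuq.
  by rewrite (expBq (in_alg E)) iotaq nuq; ring.
have : map_poly iota p %| \prod_(x : L) ('X - x%:P).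
  rewrite -finField_genPoly hL.
  by move: dvd; rewrite -(dvdp_map iota) rmorphB /= map_polyXn map_polyX.
case/dvdp_prod_XsubC => s; case: (mask _ _) => [|nu r] e.
  by have := eqp_size e; rewrite size_map_poly sz big_nil size_poly1.
exists nu; apply/eqP; rewrite -(pE _ iota) -[_ == 0]/(root _ nu) (eqp_root e).
by rewrite root_prod_XsubC mem_head.
Qed.
(** The constant W of [sum_inv_shift] is [mu - nu] at the pole [nu] and its opposite at [mu], whence
    the signs at odd orders. For q = 2 the sum of [x] is 1 and inverse cubes are not covered, so
    those terms must then be absent. *)
Lemma sum_inv_shift_lin (F : finFieldType) (K : fieldType) (iota : {rmorphism F -> K})
    (nu mu k0 k1 k2 k3 k4 k5 k6 k7 : K) (g : F -> K) :
  nu ^+ #|F| = mu -> mu ^+ #|F| = nu -> mu != nu ->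
  (k1 = 0 /\ k6 = 0 /\ k7 = 0) \/ (2 < #|F|)%N ->
  (forall x, g x = k0 + k1 * iota x
    + k2 * (iota x - nu)^-1 + k3 * (iota x - mu)^-1
    + k4 * (iota x - nu)^-1 ^+ 2 + k5 * (iota x - mu)^-1 ^+ 2
    + k6 * (iota x - nu)^-1 ^+ 3 + k7 * (iota x - mu)^-1 ^+ 3) ->
  \sum_x g x = (k2 - k3) / (mu - nu) + (k4 + k5) / (mu - nu) ^+ 2
    + (k6 - k7) / (mu - nu) ^+ 3.
Proof.
move=> nuq muq ne k67 gE.
have [|A1 A2 A3] := @sum_inv_shift F K iota nu; first by rewrite nuq.
have [|B1 B2 B3] := @sum_inv_shift F K iota mu; first by rewrite muq eq_sym.
have d0 : mu - nu != 0 by rewrite subr_eq0.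
have d1 : nu - mu != 0 by rewrite subr_eq0 eq_sym.
under eq_bigr do rewrite gE.
rewrite !big_split /= -!mulr_sumr.
have -> : \sum_(x : F) k0 = 0.
  transitivity (k0 * \sum_(x : F) 1); last by rewrite (sum_card0 iota) mulr0.
  by rewrite mulr_sumr; apply: eq_bigr => x _; rewrite mulr1.
rewrite A1 A2 B1 B2 nuq muq.
case: k67 => [[-> [-> ->]]|q2].
  by rewrite !mul0r; field; rewrite ?d0 ?d1.
rewrite A3 // B3 // nuq muq.
have -> : \sum_(x : F) iota x = 0.
  under eq_bigr do rewrite -[iota _]expr1.
  by apply: sum_iota_expf; rewrite -ltnS (ltn_predK q2).
by field; rewrite ?d0 ?d1.
Qed.

(** * Permutations of [F] with two conjugate poles *)

Lemma perm_quadratic_pole (F L : finFieldType) (iota : {rmorphism F -> L})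
    (hL : #|L| = (#|F| ^ 2)%N) (t m r s : F) :
  (forall x : F, x ^+ 2 - t * x + m != 0) ->
  injective (fun x => x + (r * x + s) / (x ^+ 2 - t * x + m)) ->
  (r = 0 /\ s = 0) \/ (r = - 2%:R * (t ^+ 2 - 4%:R * m) /\ s = t * (t ^+ 2 - 4%:R * m)).
Proof.
move=> irr; set h := fun x => _ => hinj.
have [nu e] := quadratic_root_ext iota hL irr.
have [nuq ne] := conj_quadratic_root irr e.
have muq : (nu ^+ #|F|) ^+ #|F| = nu.
  by rewrite nuq (expBq iota) iotaq nuq; ring.
set mu := nu ^+ #|F| in nuq ne muq.
have tE : iota t = nu + mu by rewrite nuq; ring.
have mE : iota m = nu * mu by rewrite -[RHS]addr0 -e tE; ring.
have d0 : mu - nu != 0 by rewrite subr_eq0.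
have d1 : nu - mu != 0 by rewrite subr_eq0 eq_sym.
have nu0 x : iota x - nu != 0.
  by apply: contraNneq ne => /eqP; rewrite subr_eq0 => /eqP xE; rewrite /mu -xE iotaq.
have mu0 x : iota x - mu != 0.
  by apply: contraNneq ne => /eqP; rewrite subr_eq0 => /eqP xE; rewrite -muq -xE iotaq.
have QE x : iota (x ^+ 2 - t * x + m) = (iota x - nu) * (iota x - mu).
  by rewrite rmorphD rmorphB rmorphXn rmorphM tE mE; ring.
(* [rho] and [rho'] are the residues of [(r x + s) / (x^2 - t x + m)] at [nu] and [mu]. *)
pose rho := (iota r * nu + iota s) / (nu - mu).
pose rho' := (iota r * mu + iota s) / (mu - nu).
have hE x : iota (h x) = iota x + rho * (iota x - nu)^-1 + rho' * (iota x - mu)^-1.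
  rewrite /h rmorphD fmorph_div QE rmorphD rmorphM /rho /rho'.
  by field; rewrite nu0 mu0 d0 d1.
have hsum k : \sum_x (iota (h x) ^+ k - iota x ^+ k) = 0.
  have := reindex_inj (op := +%R) (x := 0) (P := predT) (F := fun x => iota x ^+ k) hinj.
  by rewrite sumrB => /= ->; rewrite subrr.
(* First power sums: the residues are equal, so [r] and [s] depend on [rho] alone. *)
have rr : rho' = rho.
  have := hsum 1%N.
  rewrite (@sum_inv_shift_lin F L iota nu mu 0 0 rho rho' 0 0 0 0) //; last first.
  - by move=> x; rewrite !expr1 hE; ring.
  - by left.
  rewrite subrr !(addr0, mul0r) => /eqP.
  by rewrite mulf_eq0 invr_eq0 (negPf d0) orbF subr_eq0 => /eqP.
have rE : iota r = 2%:R * rho.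
  rewrite (_ : 2%:R * rho = rho + rho'); last by rewrite rr; ring.
  by rewrite /rho /rho'; field; rewrite d0 d1.
have sE : iota s = - rho * iota t.
  rewrite (_ : - rho * iota t = - rho * mu - rho' * nu); last by rewrite rr tE; ring.
  by rewrite /rho /rho'; field; rewrite d0 d1.
have DE : iota (t ^+ 2 - 4%:R * m) = (mu - nu) ^+ 2.
  by rewrite rmorphB rmorphXn rmorphM rmorph_nat tE mE; ring.
clearbody rho rho'; subst rho'.
suff [r0|rD] : rho = 0 \/ rho = - (mu - nu) ^+ 2.
- left; split; apply: (fmorph_inj iota); first by rewrite rE r0 rmorph0 mulr0.
  by rewrite sE r0 rmorph0 oppr0 mul0r.
- right; split; apply: (fmorph_inj iota).
    by rewrite rE rmorphM rmorphN rmorph_nat DE rD; ring.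
  by rewrite sE rmorphM DE rD; ring.
(* Second power sums. The coefficients passed on are the partial fractions of [h^2 - x^2]; the sum,
   multiplied by [- (mu - nu) ^+ 2], is the left-hand side. *)
have k2 : 2%:R * (rho * (rho + (mu - nu) ^+ 2)) = 0.
  have := hsum 2%N.
  rewrite (@sum_inv_shift_lin F L iota nu mu (4%:R * rho) 0
     (2%:R * rho * nu + 2%:R * rho ^+ 2 / (nu - mu))
     (2%:R * rho * mu - 2%:R * rho ^+ 2 / (nu - mu)) (rho ^+ 2) (rho ^+ 2) 0 0) //; last first.
  - by move=> x; rewrite hE; field; rewrite nu0 mu0 d1.
  - by left.
  move=> E; rewrite -[RHS](mulr0 (- (mu - nu) ^+ 2)) -[in RHS]E; field.
  by rewrite d0 d1.
(* In characteristic 2 the second power sums say nothing, and the third ones take over. *)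
have [two0|two0] := eqVneq (2%:R : L) 0; last first.
  move/eqP: k2; rewrite mulf_eq0 (negPf two0) /= mulf_eq0 => /orP[/eqP->|]; first by left.
  by rewrite addr_eq0 => /eqP ->; right.
have t0 : nu + mu != 0.
  by apply: contra_neq d0 => H; rewrite -H -[LHS]addr0 -(mulr0 nu) -two0; ring.
have [q2|q2] := ltnP 2 #|F|.
  have := hsum 3%N.
  rewrite (@sum_inv_shift_lin F L iota nu mu (3%:R * rho * (nu + mu)) (6%:R * rho)
     (3%:R * rho * nu ^+ 2 + 3%:R * rho ^+ 2 + 6%:R * rho ^+ 2 * nu / (nu - mu))
     (3%:R * rho * mu ^+ 2 + 3%:R * rho ^+ 2 - 6%:R * rho ^+ 2 * mu / (nu - mu))
     (3%:R * rho ^+ 2 * nu + 3%:R * rho ^+ 3 / (nu - mu))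
     (3%:R * rho ^+ 2 * mu - 3%:R * rho ^+ 3 / (nu - mu)) (rho ^+ 3) (rho ^+ 3)) //; last first.
  - by move=> x; rewrite hE; field; rewrite nu0 mu0 d1.
  - by right.
  move=> E.
  have : rho * (rho + (mu - nu) ^+ 2) * (nu + mu) = 0.
    rewrite -[RHS](mulr0 (- (mu - nu) ^+ 2)) -[in RHS]E.
    (* The sum yields three times the product; adding twice the product, which is 0 here, supplies
       the factor 3. *)
    rewrite -[LHS]addr0 -(mulr0 (rho * (rho + (mu - nu) ^+ 2) * (nu + mu))) -two0; field.
    by rewrite d0 d1.
  move/eqP; rewrite mulf_eq0 (negPf t0) orbF mulf_eq0 => /orP[/eqP->|]; first by left.
  by rewrite addr_eq0 => /eqP ->; right.
(* Over the field of two elements [t = 1] and [(mu - nu) ^+ 2 = 1], so the two values of [s] are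
   exactly the two alternatives. *)
have q2E : #|F| = 2 by apply/eqP; rewrite eqn_leq q2 card_finNzRing_gt1.
have x01 (x : F) : x != 0 -> x = 1.
  by move=> x0; have := expf_card_pred x0; rewrite q2E.
have t1 : iota t = 1.
  by rewrite (x01 t) ?rmorph1 // -(fmorph_eq0 iota) tE.
have DE1 : (mu - nu) ^+ 2 = 1.
  have -> : 1 = iota t ^+ 2 by rewrite t1 expr1n.
  by rewrite tE -[LHS]addr0 -(mul0r (2%:R * nu * mu)) -two0; ring.
rewrite DE1; move: sE; rewrite t1 mulr1 => sE.
have [s0|/x01 s1] := eqVneq s 0.
  by left; apply/eqP; rewrite -oppr_eq0 -sE s0 rmorph0.
by right; rewrite -[rho]opprK -sE s1 rmorph1.
Qed.
Lemma three_eq0_card (F : finFieldType) : (3%:R == 0 :> F) = (#|F| %% 3 == 0)%N.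
Proof.
have [p p_pr pF] := finPcharP F.
have qE : #|F| = (p ^ logn p #|F|)%N by exact: (card_pprimeChar pF).
rewrite -(dvdn_pcharf pF) dvdn_prime2 // -[(_ %% _ == 0)%N]/(3 %| #|F|)%N.
rewrite qE Euclid_dvdX // dvdn_prime2 // eq_sym.
case: (logn _ _) qE (card_finNzRing_gt1 F) => [->|n _ _] //.
by rewrite andbT.
Qed.

(** * Linear equivalence, and 2 by 2 matrices over [F] *)

Section LinearEquivalence.
Variable F : fieldType.
Implicit Types U V W : zmodType.

Lemma Flinear_comp U V W (sU : F -> U -> U) (sV : F -> V -> V) (sW : F -> W -> W) g h :
  Flinear sV sW g -> Flinear sU sV h -> Flinear sU sW (g \o h).
Proof. by move=> [gD gZ] [hD hZ]; split=> [x y|k x] /=; rewrite ?hD ?hZ ?gD ?gZ. Qed.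

Lemma Flinear_can U V (sU : F -> U -> U) (sV : F -> V -> V) h h' :
  Flinear sU sV h -> cancel h h' -> cancel h' h -> Flinear sV sU h'.
Proof.
move=> [hD hZ] hK h'K; split=> [x y|k x]; apply: (can_inj hK).
  by rewrite hD !h'K.
by rewrite hZ !h'K.
Qed.

Lemma lin_equiv_trans U V W (sU : F -> U -> U) (sV : F -> V -> V) (sW : F -> W -> W) f g h :
  lin_equiv sU sV f g -> lin_equiv sV sW g h -> lin_equiv sU sW f h.
Proof.
move=> [r1 [e1 [r1L r1B e1L e1B E1]]] [r2 [e2 [r2L r2B e2L e2B E2]]].
exists (r1 \o r2), (e1 \o e2); split.
- exact: Flinear_comp r1L r2L.
- exact: bij_comp.
- exact: Flinear_comp e1L e2L.
- exact: bij_comp.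
- by move=> v /=; rewrite E1 E2.
Qed.

Lemma lin_equiv_sym U V (sU : F -> U -> U) (sV : F -> V -> V) f g :
  lin_equiv sU sV f g -> lin_equiv sV sU g f.
Proof.
move=> [r [e [rL [r' rK r'K] eL [e' eK e'K] E]]].
exists r', e'; split.
- exact: Flinear_can rL rK r'K.
- by exists r.
- exact: Flinear_can eL eK e'K.
- by exists e.
- by move=> u; apply: (can_inj rK); rewrite -E e'K r'K.
Qed.

Lemma lin_equiv_bij U V (sU : F -> U -> U) (sV : F -> V -> V) f g :
  lin_equiv sU sV f g -> bijective g -> bijective f.
Proof.
move=> [r [e [_ rB _ [e' eK e'K] E]]] gB.
apply: (@eq_bij _ _ (r \o g \o e')).
  by apply: bij_comp; [exact: bij_comp | exists e].
by move=> u /=; rewrite -E e'K.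
Qed.

Definition lin2 (a b c d : F) (v : F * F) : F * F :=
  (a * v.1 + b * v.2, c * v.1 + d * v.2).

Lemma lin2_Flinear a b c d : Flinear (@scaleP F) (@scaleP F) (lin2 a b c d).
Proof.
by split=> [[x y] [z w]|k [x y]]; rewrite /lin2 /scaleP /=;
   apply: (congr2 pair) => /=; ring.
Qed.

Lemma lin2_bij a b c d : a * d - b * c != 0 -> bijective (lin2 a b c d).
Proof.
move=> D0; pose D := a * d - b * c.
by exists (lin2 (d / D) (- b / D) (- c / D) (a / D)) => -[x y];
   rewrite /lin2 /D; congr (_, _) => /=; field.
Qed.

Lemma lin_equiv_lin2 (f g : F * F -> F * F) (a b c d a' b' c' d' : F) :
  a * d - b * c != 0 -> a' * d' - b' * c' != 0 ->
  (forall v, f (lin2 a' b' c' d' v) = lin2 a b c d (g v)) ->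
  lin_equiv (@scaleP F) (@scaleP F) f g.
Proof.
move=> D D' E; exists (lin2 a b c d), (lin2 a' b' c' d').
by split=> //; [exact: lin2_Flinear | exact: lin2_bij | exact: lin2_Flinear | exact: lin2_bij].
Qed.

Lemma lin_equiv_post (f g : F * F -> F * F) (a b c d : F) :
  a * d - b * c != 0 -> (forall v, f v = lin2 a b c d (g v)) ->
  lin_equiv (@scaleP F) (@scaleP F) f g.
Proof.
move=> D E; apply: (@lin_equiv_lin2 _ _ a b c d 1 0 0 1) => //.
  by rewrite mulr1 mulr0 subr0 oner_neq0.
by move=> [x y]; rewrite -E /lin2 /= !(mul1r, mul0r, addr0, add0r).
Qed.

End LinearEquivalence.

(** * Coordinates of [L] over [F] *)

Section PairBasis.
Variables (F L : finFieldType) (iota : {rmorphism F -> L}).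
Hypothesis hL : #|L| = (#|F| ^ 2)%N.

Definition pairL (u w : L) (v : F * F) : L := iota v.1 * u + iota v.2 * w.

Lemma pairL_Flinear u w : Flinear (@scaleP F) (scaleL iota) (pairL u w).
Proof.
split=> [[x y] [z t]|k [x y]]; rewrite /pairL /scaleL /=.
  by rewrite !rmorphD /=; ring.
by rewrite !rmorphM /=; ring.
Qed.

(** Subtracting a linear relation between 1 and [w] from its [q]-th power leaves a multiple of
    [w ^+ q - w]; surjectivity follows by counting. *)
Lemma pairL_bij w : w ^+ #|F| != w -> bijective (pairL 1 w).
Proof.
move=> wq; apply: inj_card_bij; last by rewrite card_prod hL.
move=> [x y] [x' y']; rewrite /pairL /= !mulr1 => e.
have e2 : iota (x - x') = iota (y' - y) * w.
  by rewrite !rmorphB; apply/eqP; rewrite -subr_eq0; apply/eqP;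
     rewrite -(subrr (iota x' + iota y' * w)) -{1}e; ring.
have e3 : iota (x - x') = iota (y' - y) * w ^+ #|F|.
  by have := congr1 (fun z => z ^+ #|F|) e2; rewrite exprMn !iotaq.
have /eqP : iota (y' - y) * (w ^+ #|F| - w) = 0 by rewrite mulrBr -e2 -e3 subrr.
rewrite mulf_eq0 (subr_eq0 _ w) (negPf wq) orbF => /eqP y0; move: e2.
rewrite y0 mul0r => /eqP; rewrite fmorph_eq0 subr_eq0 => /eqP ->.
by move/eqP: y0; rewrite fmorph_eq0 subr_eq0 => /eqP ->.
Qed.

End PairBasis.

(** * Normal forms for bijective pairs of binary cubic forms *)

Section CubicMaps.
Variable F : finFieldType.
Local Notation q := #|F|.
Local Notation equivP := (lin_equiv (@scaleP F) (@scaleP F)).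

Definition cform (p0 p1 p2 p3 : F) (v : F * F) : F :=
  p0 * v.1 ^+ 3 + p1 * v.1 ^+ 2 * v.2 + p2 * v.1 * v.2 ^+ 2 + p3 * v.2 ^+ 3.

Definition cubes (v : F * F) : F * F := (v.1 ^+ 3, v.2 ^+ 3).

(** Homogenized numerator and denominator of [x + (r x + s) / (x^2 - t x + m)] at
    [x = v.1 / v.2]. *)
Definition quad_normal (t m r s : F) (v : F * F) : F * F :=
  (v.1 * (v.1 ^+ 2 - t * v.1 * v.2 + m * v.2 ^+ 2) + (r * v.1 + s * v.2) * v.2 ^+ 2,
   v.2 * (v.1 ^+ 2 - t * v.1 * v.2 + m * v.2 ^+ 2)).

Lemma cube_surj (k : F) : (q %% 3 != 1)%N -> exists l : F, l ^+ 3 = k.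
Proof.
move=> q3; have [g _ gK] := injF_bij (cube_inj q3).
by exists (g k); rewrite gK.
Qed.

(** At a root [x], the image of [(x, 1)] is [(l ^+ 3, 0)] for some [l], which is also the image of
    [(l, 0)]. *)
Lemma monic_cubic_no_root p1 p2 p3 q1 q2 q3 : (q %% 3 != 1)%N ->
  bijective (fun v => (cform 1 p1 p2 p3 v, cform 0 q1 q2 q3 v)) ->
  forall x, q1 * x ^+ 2 + q2 * x + q3 != 0.
Proof.
move=> qn3 /bij_inj inj x; apply/eqP => e.
have [l lE] := cube_surj (cform 1 p1 p2 p3 (x, 1)) qn3.
suff /inj[_ /eqP] : (fun v => (cform 1 p1 p2 p3 v, cform 0 q1 q2 q3 v)) (x, 1) =
  (fun v => (cform 1 p1 p2 p3 v, cform 0 q1 q2 q3 v)) (l, 0) by rewrite oner_eq0.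
rewrite /= -lE; congr (_, _); rewrite /cform /=; first by ring.
by transitivity (q1 * x ^+ 2 + q2 * x + q3); [ring | rewrite e; ring].
Qed.

Lemma monic_cubic_normal p1 p2 p3 q1 q2 q3 : (q %% 3 != 1)%N -> q1 != 0 ->
  bijective (fun v => (cform 1 p1 p2 p3 v, cform 0 q1 q2 q3 v)) ->
  exists t m r s, (forall x, x ^+ 2 - t * x + m != 0) /\
    equivP (fun v => (cform 1 p1 p2 p3 v, cform 0 q1 q2 q3 v)) (quad_normal t m r s).
Proof.
move=> qn3 q10 Gb; have nr := monic_cubic_no_root qn3 Gb.
(* Euclidean division of the first cubic, at [v.2 = 1], by the monic quadratic: quotient [x + c],
   remainder [r x + s]. *)
pose c := p1 - q2 / q1.
exists (- q2 / q1), (q3 / q1), (p2 - q3 / q1 - c * q2 / q1), (p3 - c * q3 / q1); split.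
  move=> x; apply: contra_neq (nr x) => e.
  by rewrite -(mulr0 q1) -e; field.
apply: (@lin_equiv_post _ _ _ 1 c 0 q1); first by rewrite mul1r mulr0 subr0.
move=> [x y]; rewrite /lin2 /quad_normal /cform /c /=.
by congr (_, _); field.
Qed.

Lemma cubic_normal_monic p1 p2 p3 q1 q2 q3 : (q %% 3 != 1)%N ->
  let G := fun v => (cform 1 p1 p2 p3 v, cform 0 q1 q2 q3 v) in
  bijective G -> equivP G cubes \/
  exists t m r s, (forall x, x ^+ 2 - t * x + m != 0) /\ equivP G (quad_normal t m r s).
Proof.
move=> qn3 G Gb; have nr := monic_cubic_no_root qn3 Gb.
have [q10|] := eqVneq q1 0; last by right; exact: monic_cubic_normal.
have q20 : q2 = 0.
  apply/eqP; apply: contraT => q20; have /eqP[] := nr (- q3 / q2).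
  by rewrite q10; field.
have q30 : q3 != 0 by have := nr 0; rewrite !(mulr0, expr0n, add0r).
pose G2 (v : F * F) := (cform 1 p1 p2 0 v, cform 0 0 0 1 v).
have GG2 : equivP G G2.
  apply: (@lin_equiv_post _ _ _ 1 p3 0 q3); first by rewrite mul1r mulr0 subr0.
  by move=> [x y]; rewrite /G /G2 /lin2 /cform /= q10 q20; congr (_, _); ring.
have G2b := lin_equiv_bij (lin_equiv_sym GG2) Gb.
have [p20|p20] := eqVneq p2 0.
  left; apply: lin_equiv_trans GG2 _.
  suff p10 : p1 = 0.
    apply: (@lin_equiv_post _ _ _ 1 0 0 1); first by rewrite mul1r mulr0 subr0 oner_neq0.
    by move=> [x y]; rewrite /G2 /lin2 /cform /cubes /= p10 p20; congr (_, _); ring.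
  have /(bij_inj G2b)[/eqP] : G2 (- p1, 1) = G2 (0, 1).
    by rewrite /G2 /cform /= p20; congr (_, _); ring.
  by rewrite oppr_eq0 => /eqP.
(* Swapping the coordinates in source and target makes [p2], which is nonzero, the leading
   coefficient of the quadratic. *)
right; pose G3 (v : F * F) := (cform 1 0 0 0 v, cform 0 p2 p1 1 v).
have GG3 : equivP G G3.
  apply: lin_equiv_trans GG2 _.
  have d : 0 * 0 - 1 * 1 != 0 :> F by rewrite mul0r mul1r sub0r oppr_eq0 oner_neq0.
  apply: (@lin_equiv_lin2 _ _ _ 0 1 1 0 0 1 1 0) => //.
  by move=> [x y]; rewrite /G2 /G3 /lin2 /cform /=; congr (_, _); ring.
have G3b := lin_equiv_bij (lin_equiv_sym GG3) Gb.
have [t [m [r [s [irr E]]]]] := monic_cubic_normal qn3 p20 G3b.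
by exists t, m, r, s; split=> //; apply: lin_equiv_trans GG3 E.
Qed.

(** The image [(p0, q0)] of [(1, 0)] is nonzero by injectivity, so a linear change of the target
    moves it to [(1, 0)]. *)
Lemma cubic_normal p0 p1 p2 p3 q0 q1 q2 q3 : (q %% 3 != 1)%N ->
  let G := fun v => (cform p0 p1 p2 p3 v, cform q0 q1 q2 q3 v) in
  bijective G -> equivP G cubes \/
  exists t m r s, (forall x, x ^+ 2 - t * x + m != 0) /\ equivP G (quad_normal t m r s).
Proof.
move=> qn3 G Gb.
suff [p1' [p2' [p3' [q1' [q2' [q3' E]]]]]] : exists p1' p2' p3' q1' q2' q3',
    equivP G (fun v => (cform 1 p1' p2' p3' v, cform 0 q1' q2' q3' v)).
  have Gb' := lin_equiv_bij (lin_equiv_sym E) Gb.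
  have [E'|[t [m [r [s [irr E']]]]]] := cubic_normal_monic qn3 Gb'.
    by left; apply: lin_equiv_trans E E'.
  by right; exists t, m, r, s; split=> //; apply: lin_equiv_trans E E'.
have [p00|p00] := eqVneq p0 0; last first.
  exists (p1 / p0), (p2 / p0), (p3 / p0), (q1 - q0 * p1 / p0), (q2 - q0 * p2 / p0),
    (q3 - q0 * p3 / p0).
  apply: (@lin_equiv_post _ _ _ p0 0 q0 1); first by rewrite mulr1 mul0r subr0.
  by move=> [x y]; rewrite /G /lin2 /cform /=; congr (_, _); field.
have q00 : q0 != 0.
  apply/eqP => q00; have /(bij_inj Gb)[/eqP] : G (1, 0) = G (0, 0).
    by rewrite /G /cform /= p00 q00; congr (_, _); ring.
  by rewrite oner_eq0.
exists (q1 / q0), (q2 / q0), (q3 / q0), p1, p2, p3.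
apply: (@lin_equiv_post _ _ _ 0 1 q0 0); first by rewrite mulr0 mul1r sub0r oppr_eq0.
by move=> [x y]; rewrite /G /lin2 /cform /= p00; congr (_, _); field.
Qed.

(** Equal values at [x] and [y] make the images of [(x, 1)] and [(y, 1)] proportional; the ratio is
    a cube [l ^+ 3], absorbed by scaling [(y, 1)] by [l]. *)
Lemma quad_normal_inj t m r s : (q %% 3 != 1)%N ->
  (forall x, x ^+ 2 - t * x + m != 0) -> injective (quad_normal t m r s) ->
  injective (fun x => x + (r * x + s) / (x ^+ 2 - t * x + m)).
Proof.
move=> qn3 irr inj x y /= e.
have [l lE] := cube_surj ((x ^+ 2 - t * x + m) / (y ^+ 2 - t * y + m)) qn3.
have /inj[xE l1] : quad_normal t m r s (x, 1) = quad_normal t m r s (l * y, l).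
  have -> : quad_normal t m r s (l * y, l) =
      (l ^+ 3 * (y ^+ 2 - t * y + m) * (y + (r * y + s) / (y ^+ 2 - t * y + m)),
       l ^+ 3 * (y ^+ 2 - t * y + m)).
    by rewrite /quad_normal /=; congr (_, _); field.
  rewrite lE -e /quad_normal /=; congr (_, _); field; by rewrite ?irr.
by rewrite xE -l1 mul1r.
Qed.

End CubicMaps.

(** * Identification of the two surviving normal forms *)

Section ExceptionalForms.
Variables (F L : finFieldType) (iota : {rmorphism F -> L}).
Hypothesis hL : #|L| = (#|F| ^ 2)%N.
Local Notation q := #|F|.
Variables t m : F.
Hypothesis irr : forall x, x ^+ 2 - t * x + m != 0.
Local Notation D := (t ^+ 2 - 4%:R * m).

(* x - nu y is a linear isomorphism F * F -> L whose norm is x ^ 2 - t x y + m y ^ 2. *)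
Lemma quad_normal0_equiv :
  lin_equiv (@scaleP F) (scaleL iota) (quad_normal t m 0 0) (fun x : L => x ^+ (q + 2)).
Proof.
have [nu e] := quadratic_root_ext iota hL irr.
have [nuq ne] := conj_quadratic_root irr e.
have tE : iota t = nu + nu ^+ q by rewrite nuq; ring.
have mE : iota m = nu * nu ^+ q by rewrite -[RHS]addr0 -e tE; ring.
have bij : bijective (pairL iota 1 (- nu)).
  by apply: pairL_bij => //; rewrite (expNq iota) eqr_opp.
apply: lin_equiv_sym; exists (pairL iota 1 (- nu)), (pairL iota 1 (- nu)).
split; [exact: pairL_Flinear | by [] | exact: pairL_Flinear | by [] |].
(* For z = x - nu y, z^(q+2) is z times its norm z^(q+1), a scalar in [F]. *)
move=> [x y]; rewrite /pairL /quad_normal /= exprD.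
rewrite (expDq iota) !exprMn (expNq iota) !iotaq expr1n.
rewrite !(rmorphD, rmorphB, rmorphM, rmorphN, rmorph0) /= tE mE.
by ring.
Qed.

Lemma disc_neq0 : D != 0.
Proof.
have [nu e] := quadratic_root_ext iota hL irr.
have [nuq ne] := conj_quadratic_root irr e.
rewrite -(fmorph_eq0 iota) (_ : iota D = (nu ^+ q - nu) ^+ 2).
  by rewrite expf_neq0 // subr_eq0.
rewrite rmorphB rmorphXn rmorphM rmorph_nat nuq /=.
by rewrite -[LHS]addr0 -(mulr0 4%:R) -e; ring.
Qed.

(* If w is a primitive cube root of unity and nu, mu are the conjugate roots of X ^ 2 - t X + m,
   then w nu + w ^ 2 mu lies in F. *)
Lemma cube_resolvent_root : (q %% 3 = 2)%N ->
  exists k : F, k ^+ 2 + t * k + (t ^+ 2 - 3%:R * m) = 0.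
Proof.
move=> q3; have [nu e] := quadratic_root_ext iota hL irr.
have [nuq ne] := conj_quadratic_root irr e.
have muq : (nu ^+ q) ^+ q = nu.
  by rewrite nuq (expBq iota) iotaq nuq; ring.
have [|w w0] := @exists_cubic_root1 L; first by rewrite hL -modnXm q3.
have w3 : w ^+ 3 = 1.
  apply/eqP; rewrite -subr_eq0; apply/eqP; rewrite -(mulr0 (w - 1)) -w0; ring.
(* As q = 2 mod 3, the [q]-th power swaps w and w^2 as well as the two roots, and so fixes w nu +
   w^2 mu. *)
have wq : w ^+ q = w ^+ 2.
  by rewrite (divn_eq q 3) q3 exprD mulnC exprM w3 expr1n mul1r.
set mu := nu ^+ q in nuq ne muq.
have tE : iota t = nu + mu by rewrite nuq; ring.
have mE : iota m = nu * mu by rewrite -[RHS]addr0 -e tE; ring.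
have [|k kE] := @fixed_in_base F L iota (w * nu + w ^+ 2 * mu).
  rewrite (expDq iota) (exprMn _ w nu) (exprMn _ (w ^+ 2) mu) muq -/mu exprAC wq.
  by rewrite -exprM (exprD w 3 1) w3 expr1; ring.
exists k; apply: (fmorph_inj iota); rewrite rmorph0.
rewrite !rmorphD rmorphN !rmorphXn !rmorphM rmorph_nat -kE tE mE /=.
have w2 : w ^+ 2 = - 1 - w by rewrite -[LHS]subr0 -w0; ring.
by ring: w2.
Qed.

(** For each root k of the resolvent quadratic, the first form plus [3 k + t] times the second is
    the cube of [x + k y]. The roots are [k] and [- t - k]. *)
Lemma quad_normalD_equiv_cubes : (q %% 3 = 2)%N ->
  lin_equiv (@scaleP F) (@scaleP F) (quad_normal t m (- 2%:R * D) (t * D)) (@cubes F).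
Proof.
move=> q3; have [k kE] := cube_resolvent_root q3.
have three0 : 3%:R != 0 :> F by rewrite three_eq0_card q3.
(* The roots are distinct: the square of their difference is -3D. *)
have d : - t - k - k != 0.
  apply: contra_neq (mulf_neq0 three0 disc_neq0) => d.
  transitivity (4%:R * (k ^+ 2 + t * k + (t ^+ 2 - 3%:R * m)) - (- t - k - k) ^+ 2).
    by ring.
  by rewrite kE d; ring.
have cE k' : k' ^+ 2 + t * k' + (t ^+ 2 - 3%:R * m) = 0 -> forall x y : F,
   (x + k' * y) ^+ 3 = (quad_normal t m (- 2%:R * D) (t * D) (x, y)).1
     + (3%:R * k' + t) * (quad_normal t m (- 2%:R * D) (t * D) (x, y)).2.
  move=> k'E x y.
  transitivity ((x + k' * y) ^+ 3 + (k' ^+ 2 + t * k' + (t ^+ 2 - 3%:R * m)) *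
    (- 3%:R * x * y ^+ 2 + (t - k') * y ^+ 3)); first by rewrite k'E mul0r addr0.
  by rewrite /quad_normal /=; ring.
apply: lin_equiv_sym.
apply: (@lin_equiv_lin2 _ _ _ 1 (3%:R * k + t) 1 (3%:R * (- t - k) + t) 1 k 1 (- t - k)).
- rewrite (_ : _ - _ = 3%:R * (- t - k - k)); last by ring.
  by rewrite mulf_neq0.
- by rewrite mul1r mulr1.
move=> [x y]; rewrite /lin2 /cubes; congr (_, _); rewrite !mul1r.
  exact: cE.
by apply: cE; rewrite -kE; ring.
Qed.

(** The quadratic formula would give a root in [F]. *)
Lemma disc_nonsquare : 2%:R != 0 :> F -> forall y : F, y ^+ 2 != D.
Proof.
move=> two0 y; apply/eqP => e; have /eqP[] := irr ((t + y) / 2%:R).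
transitivity ((y ^+ 2 - D) / 4%:R); last by rewrite e subrr mul0r.
have four0 : 4%:R != 0 :> F by rewrite -[4%N]/(2 * 2)%N natrM mulf_neq0.
by field; rewrite ?two0 ?four0.
Qed.

(** Put X = y and Y = x + t y. In characteristic 3, x^2 - t x y + m y^2 = Y^2 - D X^2, so the second
    form is -D (X^3 - D^-1 X Y^2), and the first plus t times the second is Y^3. *)
Lemma quad_normalD_equiv_pchar3 : 3%:R = 0 :> F ->
  lin_equiv (@scaleP F) (@scaleP F) (quad_normal t m (- 2%:R * D) (t * D))
    (fun v => (v.1 ^+ 3 - D^-1 * v.1 * v.2 ^+ 2, v.2 ^+ 3)).
Proof.
move=> three0.
have two0 : 2%:R != 0 :> F.
  apply: contra_neq (oner_neq0 F) => two0; rewrite -three0 -[LHS]addr0 -two0; ring.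
have D0 := disc_neq0.
apply: lin_equiv_sym.
apply: (@lin_equiv_lin2 _ _ _ 0 (- D^-1) 1 t 0 1 1 t).
- by rewrite mul0r sub0r mulr1 opprK invr_neq0.
- by rewrite mul0r sub0r mulr1 oppr_eq0 oner_neq0.
move=> [x y]; rewrite /lin2 /quad_normal /=; congr (_, _).
  transitivity (y ^+ 3 - D^-1 * y * (x + t * y) ^+ 2 + 3%:R * (D^-1 * y * (t * x * y + m * y ^+ 2))).
    by rewrite three0; field.
  by field.
transitivity ((x + t * y) ^+ 3 + 3%:R * (- t * x ^+ 2 * y  + (3%:R * m - 2%:R * t^+2) * x * y ^+ 2 + (- t * m) * y ^+ 3)).
  by rewrite three0; ring.
by ring.
Qed.

End ExceptionalForms.

(** * Bijectivity of the three listed maps *)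

(** Since q^2 - 1 = (q + 2)(q - 2) + 3, the gcd of q + 2 and q^2 - 1 divides 3, and 3 divides q + 2
    only if q = 1 mod 3. *)
Lemma norm_mul_bij (F L : finFieldType) : #|L| = (#|F| ^ 2)%N ->
  (#|F| %% 3 != 1)%N -> bijective (fun x : L => x ^+ (#|F| + 2)).
Proof.
move=> hL q3; apply: injF_bij; apply: expf_coprime_inj; first by rewrite addn2.
have q1 : (1 < #|F|)%N := card_finNzRing_gt1 F.
have g1 : (gcdn (#|F| + 2) #|L|.-1 %| 3)%N.
  have L3 : (#|L|.-1 = (#|F| + 2) * (#|F| - 2) + 3)%N by rewrite hL; nia.
  rewrite -(@dvdn_addr ((#|F| + 2) * (#|F| - 2))); last exact/dvdn_mulr/dvdn_gcdl.
  by rewrite -L3 dvdn_gcdr.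
rewrite /coprime; have := dvdn_gcdl (#|F| + 2) #|L|.-1.
have /primeP[_ /(_ _ g1)/orP[/eqP->|/eqP->]] : prime 3 by [].
  by [].
by lia.
Qed.

Lemma cubes_bij (F : finFieldType) : (#|F| %% 3 != 1)%N -> bijective (@cubes F).
Proof.
move=> q3; apply: injF_bij => -[x y] [z w] [e1 e2].
by rewrite (cube_inj q3 e1) (cube_inj q3 e2).
Qed.

(** In characteristic 3 the first coordinate is additive in [v.1]; a nonzero kernel element would
    make [e] a square. *)
Lemma additive_cubic_bij (F : finFieldType) (e : F) : (#|F| %% 3 == 0)%N ->
  ~ (exists y : F, y ^+ 2 = e) ->
  bijective (fun v : F * F => (v.1 ^+ 3 - e * v.1 * v.2 ^+ 2, v.2 ^+ 3)).
Proof.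
move=> q3 ensq; have three0 : 3%:R = 0 :> F by apply/eqP; rewrite three_eq0_card.
apply: injF_bij => -[x y] [z w] /= [e1 e2].
have yw : y = w by apply: (@cube_inj F) e2; rewrite (eqP q3).
subst w; congr (_, _); apply/eqP; rewrite -subr_eq0.
have : (x - z) * ((x - z) ^+ 2 - e * y ^+ 2) = 0.
  transitivity ((x ^+ 3 - e * x * y ^+ 2) - (z ^+ 3 - e * z * y ^+ 2)
    + 3%:R * (x * z ^+ 2 - x ^+ 2 * z)); first by ring.
  by rewrite three0 e1 subrr mul0r addr0.
move/eqP; rewrite mulf_eq0 => /orP[//|/eqP/subr0_eq sq].
apply: contraT => xz; case: ensq.
have y0 : y != 0.
  by apply: contraNneq xz => y0; move: sq; rewrite y0 expr0n mulr0 => /eqP; rewrite expf_eq0.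
by exists ((x - z) / y); rewrite expr_div_n sq mulfK // expf_neq0.
Qed.

(** * Passage from [f] to cubic forms, and the classification *)

Lemma fpoly_equiv_cubic (F L : finFieldType) (iota : {rmorphism F -> L})
    (hL : #|L| = (#|F| ^ 2)%N) (a b c d : L) :
  exists p0 p1 p2 p3 q0 q1 q2 q3 : F,
    lin_equiv (scaleL iota) (@scaleP F) (fun x : L => (fpoly #|F| a b c d).[x])
      (fun v => (cform p0 p1 p2 p3 v, cform q0 q1 q2 q3 v)).
Proof.
have q1 : (1 < #|F|)%N := card_finNzRing_gt1 F.
have [|th th0 thq] := @expf_neq1 L #|F|.-1; first by rewrite hL; nia.
have {}thq : th ^+ #|F| != th.
  by apply: contra_neq thq => e; apply: (mulfI th0); rewrite mulr1 -exprS (ltn_predK q1).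
have ebij := pairL_bij iota hL thq.
have [e' _ e'K] := ebij; set e := pairL iota 1 th in ebij e'K.
set ph := th ^+ #|F|.
(* [c0] to [c3] are the coordinate pairs of the coefficients of [f(x + y th)] as a cubic in [x] and
   [y], using [(x + y th)^q = x + y ph]. *)
pose c0 := e' (a + b + c + d).
pose c1 := e' (3%:R * a * ph + b * (2%:R * ph + th) + c * (ph + 2%:R * th) + 3%:R * d * th).
pose c2 := e' (3%:R * a * ph ^+ 2 + b * (ph ^+ 2 + 2%:R * ph * th)
             + c * (2%:R * ph * th + th ^+ 2) + 3%:R * d * th ^+ 2).
pose c3 := e' (a * ph ^+ 3 + b * ph ^+ 2 * th + c * ph * th ^+ 2 + d * th ^+ 3).
exists c0.1, c1.1, c2.1, c3.1, c0.2, c1.2, c2.2, c3.2, e, e.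
split; [exact: pairL_Flinear | by [] | exact: pairL_Flinear | by [] |].
move=> [x y]; rewrite /fpoly !hornerE.
rewrite (mulnC 3) (mulnC 2) !exprD !exprM.
have -> : e (x, y) ^+ #|F| = iota x + iota y * ph.
  by rewrite /e /pairL /= mulr1 (expDq iota) exprMn !iotaq.
transitivity (e c0 * iota x ^+ 3 + e c1 * (iota x ^+ 2 * iota y)
   + e c2 * (iota x * iota y ^+ 2) + e c3 * iota y ^+ 3).
  by rewrite !e'K /e /pairL /=; ring.
rewrite /e /pairL /cform /= !rmorphD !(rmorphM iota) /=.
by ring.
Qed.

Theorem theorem1p10 (F L : finFieldType) (iota : {rmorphism F -> L})
  (hL : #|L| = (#|F| ^ 2)%N) (a b c d : L) :
  let q := #|F| in
  let f := fun x : L => (fpoly q a b c d).[x] in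
  bijective f <->
  [\/ ((q %% 3 != 1)%N /\
        lin_equiv (scaleL iota) (scaleL iota) f (fun x : L => x ^+ (q + 2))),
      ((q %% 3 != 1)%N /\
        lin_equiv (scaleL iota) (@scaleP F) f
          (fun v : F * F => (v.1 ^+ 3, v.2 ^+ 3)))
    | ((q %% 3 == 0)%N /\
        exists e : F, [/\ e != 0, ~ (exists y : F, y ^+ 2 = e) &
          lin_equiv (scaleL iota) (@scaleP F) f
            (fun v : F * F => (v.1 ^+ 3 - e * v.1 * v.2 ^+ 2, v.2 ^+ 3))])].
Proof.
move=> q f; split; last first.
  case=> [[q3 E]|[q3 E]|[q3 [e [_ ensq E]]]]; apply: (lin_equiv_bij E).
  - exact: norm_mul_bij.
  - exact: cubes_bij.
  - exact: additive_cubic_bij.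
move=> fb; have [p0 [p1 [p2 [p3 [q0 [q1 [q2 [q3 E]]]]]]]] := fpoly_equiv_cubic iota hL a b c d.
rewrite -/q -/f in E; set G := fun v => _ in E.
have Gb := lin_equiv_bij (lin_equiv_sym E) fb.
(* Otherwise a nontrivial cube root of unity [w] gives [(w, 0)] and [(1, 0)] the same image. *)
have qn3 : (q %% 3 != 1)%N.
  apply/eqP => qE; have [w w0] := exists_cubic_root1 qE.
  have /(bij_inj Gb)[w1] : G (w, 0) = G (1, 0).
    have w3 : w ^+ 3 = 1.
      by apply/eqP; rewrite -subr_eq0; apply/eqP; rewrite -(mulr0 (w - 1)) -w0; ring.
    by rewrite /G /cform /= w3 expr1n; congr (_, _); ring.
  have := three_eq0_card F; rewrite -/q qE -w0 w1.
  by rewrite (_ : 3%:R = 1 + 1 + 1 ^+ 2) ?eqxx //; ring.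
have [Ec|[t [m [r [s [irr En]]]]]] := cubic_normal qn3 Gb.
  by apply: Or32; split=> //; exact: lin_equiv_trans E Ec.
have {En} E := lin_equiv_trans E En.
have /bij_inj Nb := lin_equiv_bij (lin_equiv_sym E) fb.
case: (perm_quadratic_pole iota hL irr (quad_normal_inj qn3 irr Nb)) => [] [rE sE]; subst r s.
  by apply: Or31; split=> //; exact: lin_equiv_trans E (quad_normal0_equiv iota hL irr).
have [q30|q30] := boolP (q %% 3 == 0)%N; last first.
  apply: Or32; split=> //; apply: lin_equiv_trans E (quad_normalD_equiv_cubes iota hL irr _).
  by rewrite -/q; lia.
have three0 : 3%:R = 0 :> F by apply/eqP; rewrite three_eq0_card.
(* [e] is the inverse of the discriminant, a nonsquare because the quadratic has no root in [F] and
   the characteristic is not 2. *)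
apply: Or33; split=> //; exists (t ^+ 2 - 4%:R * m)^-1; split.
- by rewrite invr_neq0 // (disc_neq0 iota hL irr).
- move=> [y yE].
  have two0 : 2%:R != 0 :> F.
    by apply: contra_neq (oner_neq0 F) => two0; rewrite -three0 -[LHS]addr0 -two0; ring.
  have /eqP[] := disc_nonsquare irr two0 y^-1.
  by rewrite exprVn yE invrK.
- exact: lin_equiv_trans E (quad_normalD_equiv_pchar3 iota hL irr three0).
Qed.
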